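(* (In $\mathbf{ZF}$.) Let $\mathbf{X}$ be a $T_1$-space with underlying set $X$. Then: (i) $(\mathbf{F_{\sigma}L}(\mathbf{X})\wedge\mathbf{KW}(X,\omega))\leftrightarrow\mathbf{AC}(X)$; (ii) $(\mathbf{F_{\sigma}L}(\mathbf{X})\wedge\mathbf{CKW}(X,\omega))\rightarrow\mathbf{CAC}(X)$; (iii) $(\mathbf{CF}_{\sigma}\mathbf{L}(\mathbf{X})\wedge\mathbf{CKW}(X,\omega))\leftrightarrow\mathbf{CAC}(X)$.
   Context: The result is a theorem of $\mathbf{ZF}$ (Zermelo–Fraenkel set theory without the axiom of choice). A set is countable if it is equipotent with a subset of $\omega$, and denumerable if it is countable and infinite. $[A]^{\leq\omega}$ denotes the family of all countable subsets of $A$. An $F_\sigma$-set is a countable union of closed sets. $\mathbf{AC}(X)$: every infinite family of non-empty subsets of $X$ has a choice function. $\mathbf{CAC}(X)$: every denumerable family of non-empty subsets of $X$ has a choice function. $\mathbf{KW}(X,\omega)$: for every infinite family $\mathcal{A}$ of non-empty subsets of $X$, the family $\{[A]^{\leq\omega}\setminus\{\emptyset\}:A\in\mathcal{A}\}$ has a choice function. $\mathbf{CKW}(X,\omega)$: the statement $\mathbf{KW}(X,\omega)$ restricted to denumerable families $\mathcal{A}$ of non-empty subsets of $X$. $\mathbf{F_{\sigma}L}(\mathbf{X})$: the family of all non-empty $F_\sigma$-sets of $\mathbf{X}$ has a choice function. $\mathbf{CF}_{\sigma}\mathbf{L}(\mathbf{X})$: every countable family of non-empty $F_\sigma$-subsets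 of $\mathbf{X}$ has a choice function. *)

(* Defs.v *)
(** The theorem is a theorem of ZF, so it is stated inside an arbitrary model
    [(V, ∈)] of first-order ZF. Separation and Replacement range only over
    properties defined by a first-order formula with parameters: if they ranged
    over all predicates [V -> Prop], a choice principle of the metatheory would
    yield the axiom of choice in [V]. Every notion below quantifies over the
    elements of [V] only, hence is the interpretation of a first-order formula
    of set theory. *)

Structure set_structure : Type := SetStructure {
  carrier :> Type;
  mem : carrier -> carrier -> Prop
}.

Arguments mem {_} _ _.

Notation "x ∈ a" := (mem x a) (at level 70, no associativity).
Notation "x ∉ a" := (~ mem x a) (at level 70, no associativity).

(** Formulas of the language [{∈, =}], with variables as de Bruijn indices;
    the remaining connectives are definable classically. *)
Inductive formula : Set :=
| fmem : nat -> nat -> formula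
| feq : nat -> nat -> formula
| ffalse : formula
| fimp : formula -> formula -> formula
| fall : formula -> formula.

Definition scons {V : Type} (x : V) (e : nat -> V) (n : nat) : V :=
  match n with
  | O => x
  | S m => e m
  end.

Fixpoint sat {V : set_structure} (e : nat -> V) (phi : formula) : Prop :=
  match phi with
  | fmem i j => e i ∈ e j
  | feq i j => e i = e j
  | ffalse => False
  | fimp p q => sat e p -> sat e q
  | fall p => forall x : V, sat (scons x e) p
  end.

Definition is_empty {V : set_structure} (a : V) : Prop := forall x : V, x ∉ a.

Definition nonempty {V : set_structure} (a : V) : Prop := exists x : V, x ∈ a.

Definition subset {V : set_structure} (a b : V) : Prop :=
  forall x : V, x ∈ a -> x ∈ b.

Notation "a ⊆ b" := (subset a b) (at level 70, no associativity).

Definition is_upair {V : set_structure} (u x y : V) : Prop :=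
  forall z : V, z ∈ u <-> z = x \/ z = y.

Definition is_union {V : set_structure} (u a : V) : Prop :=
  forall x : V, x ∈ u <-> exists b : V, b ∈ a /\ x ∈ b.

Definition is_powerset {V : set_structure} (p a : V) : Prop :=
  forall b : V, b ∈ p <-> b ⊆ a.

Definition is_inter {V : set_structure} (c a b : V) : Prop :=
  forall x : V, x ∈ c <-> x ∈ a /\ x ∈ b.

Definition is_diff {V : set_structure} (c a b : V) : Prop :=
  forall x : V, x ∈ c <-> x ∈ a /\ x ∉ b.

Definition is_succ {V : set_structure} (s x : V) : Prop :=
  forall y : V, y ∈ s <-> y ∈ x \/ y = x.

Definition inductive {V : set_structure} (w : V) : Prop :=
  (exists e : V, is_empty e /\ e ∈ w) /\
  (forall x : V, x ∈ w -> exists s : V, is_succ s x /\ s ∈ w).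

(** In [replacement], variable 0 of the formula is the argument and variable 1
    the value. *)
Record ZF (V : set_structure) : Prop := {
  extensionality : forall a b : V, (forall x : V, x ∈ a <-> x ∈ b) -> a = b;
  foundation : forall a : V,
    nonempty a -> exists x : V, x ∈ a /\ forall y : V, y ∈ x -> y ∉ a;
  pairing : forall x y : V, exists u : V, is_upair u x y;
  union : forall a : V, exists u : V, is_union u a;
  powerset : forall a : V, exists p : V, is_powerset p a;
  infinity : exists w : V, inductive w;
  separation : forall (phi : formula) (e : nat -> V) (a : V),
    exists b : V, forall x : V, x ∈ b <-> x ∈ a /\ sat (scons x e) phi;
  replacement : forall (phi : formula) (e : nat -> V) (a : V),
    (forall x y y' : V, x ∈ a ->
       sat (scons x (scons y e)) phi -> sat (scons x (scons y' e)) phi ->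
       y = y') ->
    exists b : V, forall y : V,
      y ∈ b <-> exists x : V, x ∈ a /\ sat (scons x (scons y e)) phi
}.

Definition is_omega {V : set_structure} (w : V) : Prop :=
  inductive w /\ forall v : V, inductive v -> w ⊆ v.

(** Kuratowski pair [p = {{x}, {x, y}}]. *)
Definition is_opair {V : set_structure} (p x y : V) : Prop :=
  exists u v : V, is_upair u x x /\ is_upair v x y /\ is_upair p u v.

(** [(x, y) ∈ f] *)
Definition maps {V : set_structure} (f x y : V) : Prop :=
  exists p : V, is_opair p x y /\ p ∈ f.

Definition function_on {V : set_structure} (f a : V) : Prop :=
  (forall p : V, p ∈ f -> exists x y : V, x ∈ a /\ is_opair p x y) /\
  (forall x : V, x ∈ a -> exists! y : V, maps f x y).

Definition bijection {V : set_structure} (f a b : V) : Prop :=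
  function_on f a /\
  (forall x y : V, maps f x y -> y ∈ b) /\
  (forall y : V, y ∈ b -> exists! x : V, maps f x y).

Definition equipotent {V : set_structure} (a b : V) : Prop :=
  exists f : V, bijection f a b.

Definition finite {V : set_structure} (a : V) : Prop :=
  exists w n : V, is_omega w /\ n ∈ w /\ equipotent a n.

Definition infinite {V : set_structure} (a : V) : Prop := ~ finite a.

Definition countable {V : set_structure} (a : V) : Prop :=
  exists w b : V, is_omega w /\ b ⊆ w /\ equipotent a b.

Definition denumerable {V : set_structure} (a : V) : Prop :=
  countable a /\ infinite a.

Definition choice_function {V : set_structure} (f A : V) : Prop :=
  function_on f A /\ forall a y : V, a ∈ A -> maps f a y -> y ∈ a.

Definition has_choice_function {V : set_structure} (A : V) : Prop :=
  exists f : V, choice_function f A.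

Definition nonempty_subsets_family {V : set_structure} (X A : V) : Prop :=
  forall a : V, a ∈ A -> a ⊆ X /\ nonempty a.

Definition AC {V : set_structure} (X : V) : Prop :=
  forall A : V, nonempty_subsets_family X A -> infinite A ->
    has_choice_function A.

Definition CAC {V : set_structure} (X : V) : Prop :=
  forall A : V, nonempty_subsets_family X A -> denumerable A ->
    has_choice_function A.

(** [c = [a]^{≤ω} \ {∅}] *)
Definition is_countable_subsets {V : set_structure} (c a : V) : Prop :=
  forall s : V, s ∈ c <-> (s ⊆ a /\ countable s) /\ ~ is_empty s.

(** [B = {[a]^{≤ω} \ {∅} : a ∈ A}]; such a [B] exists and is unique in ZF. *)
Definition is_countable_subsets_family {V : set_structure} (B A : V) : Prop :=
  forall c : V, c ∈ B <-> exists a : V, a ∈ A /\ is_countable_subsets c a.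

Definition KW_omega {V : set_structure} (X : V) : Prop :=
  forall A : V, nonempty_subsets_family X A -> infinite A ->
    forall B : V, is_countable_subsets_family B A -> has_choice_function B.

Definition CKW_omega {V : set_structure} (X : V) : Prop :=
  forall A : V, nonempty_subsets_family X A -> denumerable A ->
    forall B : V, is_countable_subsets_family B A -> has_choice_function B.

(** [T] is the family of open sets of a topology on [X]. *)
Record topology {V : set_structure} (X T : V) : Prop := {
  open_subset : forall U : V, U ∈ T -> U ⊆ X;
  open_empty : forall U : V, is_empty U -> U ∈ T;
  open_full : X ∈ T;
  open_inter : forall U1 U2 U : V,
    U1 ∈ T -> U2 ∈ T -> is_inter U U1 U2 -> U ∈ T;
  open_union : forall C U : V, C ⊆ T -> is_union U C -> U ∈ T
}.

Definition T1 {V : set_structure} (X T : V) : Prop :=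
  forall x y : V, x ∈ X -> y ∈ X -> x <> y ->
    exists U : V, U ∈ T /\ x ∈ U /\ y ∉ U.

Definition closed {V : set_structure} (X T c : V) : Prop :=
  c ⊆ X /\ exists U : V, U ∈ T /\ is_diff U X c.

Definition Fsigma {V : set_structure} (X T F : V) : Prop :=
  exists C : V, countable C /\ (forall c : V, c ∈ C -> closed X T c) /\
    is_union F C.

Definition FsigmaL {V : set_structure} (X T : V) : Prop :=
  forall A : V, (forall F : V, F ∈ A <-> Fsigma X T F /\ nonempty F) ->
    has_choice_function A.

Definition CFsigmaL {V : set_structure} (X T : V) : Prop :=
  forall A : V, (forall F : V, F ∈ A -> Fsigma X T F /\ nonempty F) ->
    countable A -> has_choice_function A.

(* Main.v *)
Require Import Defs.
From Stdlib Require Import Classical PeanoNat.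

(** In a T1 space singletons are closed, so a countable set [s] is the union of
    the countable family [{{x} : x ∈ s}] of closed sets, hence an F-sigma set
    ([countable_Fsigma]). Let [A] be a family of non-empty subsets of [X]. A
    choice function on the families [[a]^{≤ω} \ {∅}], [a ∈ A], selects in each
    [a] a non-empty countable set [s(a)], and a choice function on the F-sigma
    sets [s(a)] then selects an element of [a]
    ([choice_from_countable_subsets]). If [A] is countable, so is the family of
    the [s(a)], being an image of [A] ([image_countable]); this is where
    the choice principle for countable families of F-sigma sets suffices. It is
    implied by the principle for all F-sigma sets ([FsigmaL_choice]), which gives
    (ii) from (iii).

    Conversely, F-sigma sets are subsets of [X], and a choice function [h] for
    [A] yields [[a]^{≤ω} \ {∅} ↦ {h(a)}], well defined because [a] is the union
    of its countable subsets ([choice_of_countable_subsets]). The principles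
    AC(X) and CAC(X) concern infinite families only, so that the finite families
    of F-sigma sets are treated apart, by induction ([finite_choice]).

    All constructions take place inside the model. Separation and Replacement
    are applied to properties written in the metalanguage through the notion
    [definable], whose closure properties produce the formulas. *)

(** * Definable predicates *)

(** Renaming of the free variables; under a quantifier variable 0 is kept. *)
Fixpoint rename (r : nat -> nat) (phi : formula) : formula :=
  match phi with
  | fmem i j => fmem (r i) (r j)
  | feq i j => feq (r i) (r j)
  | ffalse => ffalse
  | fimp p q => fimp (rename r p) (rename r q)
  | fall p =>
      fall (rename (fun n => match n with O => O | S m => S (r m) end) p)
  end.

Section Definability.

Context {V : set_structure}.

Lemma sat_rename (phi : formula) :
  forall (r : nat -> nat) (d e : nat -> V), (forall n, d n = e (r n)) ->
    (sat d phi <-> sat e (rename r phi)).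
Proof.
  induction phi as [i j|i j| |p IHp q IHq|p IHp]; intros r d e H; simpl.
  - now rewrite !H.
  - now rewrite !H.
  - tauto.
  - rewrite (IHp r d e H), (IHq r d e H). tauto.
  - split; intros A x.
    + apply (IHp _ (scons x d)); [intros [|n]; simpl; auto | apply A].
    + eapply IHp; [|apply (A x)]. intros [|n]; simpl; auto.
Qed.

(** A term is a variable [inl i] or a parameter [inr v]. *)
Definition value (e : nat -> V) (t : nat + V) : V :=
  match t with
  | inl i => e i
  | inr v => v
  end.

(** A predicate of environments is definable when it is given by a formula whose
    variables have been replaced by terms; thus parameters from [V] are allowed,
    as they are in Separation and Replacement. *)
Definition definable (P : (nat -> V) -> Prop) : Prop :=
  exists (phi : formula) (s : nat -> nat + V),
    forall e, P e <-> sat (fun n => value e (s n)) phi.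

(** [t] reads a variable or is a constant parameter. *)
Definition is_term (t : (nat -> V) -> V) : Prop :=
  exists u : nat + V, forall e, t e = value e u.

Lemma is_term_var (i : nat) : is_term (fun e => e i).
Proof. now exists (inl i). Qed.

Lemma is_term_parameter (v : V) : is_term (fun _ => v).
Proof. now exists (inr v). Qed.

Lemma definable_mem (t u : (nat -> V) -> V) :
  is_term t -> is_term u -> definable (fun e => t e ∈ u e).
Proof.
  intros [a Ha] [b Hb].
  exists (fmem 0 1), (fun n => match n with O => a | _ => b end).
  intro e. simpl. now rewrite Ha, Hb.
Qed.

Lemma definable_eq (t u : (nat -> V) -> V) :
  is_term t -> is_term u -> definable (fun e => t e = u e).
Proof.
  intros [a Ha] [b Hb].
  exists (feq 0 1), (fun n => match n with O => a | _ => b end).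
  intro e. simpl. now rewrite Ha, Hb.
Qed.

Lemma definable_false : definable (fun _ => False).
Proof. exists ffalse, (fun n => inl n). simpl. tauto. Qed.

Lemma definable_equiv (P Q : (nat -> V) -> Prop) :
  (forall e, P e <-> Q e) -> definable P -> definable Q.
Proof.
  intros H [phi [s Hs]]. exists phi, s. intro e. rewrite <- H. apply Hs.
Qed.

Lemma definable_imp (P Q : (nat -> V) -> Prop) :
  definable P -> definable Q -> definable (fun e => P e -> Q e).
Proof.
  intros [phi [s Hs]] [psi [t Ht]].
  (* The even variables carry the terms of [P], the odd ones those of [Q]. *)
  exists (fimp (rename (fun n => 2 * n) phi) (rename (fun n => S (2 * n)) psi)),
    (fun n => if Nat.even n then s (Nat.div2 n) else t (Nat.div2 n)).
  intro e. rewrite Hs, Ht. cbn [sat].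
  rewrite <- (sat_rename phi _ (fun n => value e (s n))),
    <- (sat_rename psi _ (fun n => value e (t n))).
  - tauto.
  - intro n.
    now rewrite Nat.even_succ, Nat.odd_even, Nat.div2_succ_double.
  - intro n.
    now rewrite Nat.even_even, Nat.div2_double.
Qed.

(** The hypothesis reads the quantified variable as variable 0 and shifts the
    environment; the two sides match up to conversion. *)
Lemma definable_all (P : V -> (nat -> V) -> Prop) :
  definable (fun e => P (e 0) (fun n => e (S n))) ->
  definable (fun e => forall x, P x e).
Proof.
  intros [phi [s Hs]].
  exists (fall (rename (fun n => match s n with inl 0 => 0 | _ => S n end) phi)),
    (fun n => match s n with inl (S i) => inl i | t => t end).
  intro e. simpl.
  assert (H : forall x, P x e <->
    sat (scons x (fun n => value e (match s n with inl (S i) => inl i | t => t end)))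
      (rename (fun n => match s n with inl 0 => 0 | _ => S n end) phi)).
  { intro x. rewrite <- (sat_rename phi _ (fun n => value (scons x e) (s n))).
    - apply (Hs (scons x e)).
    - intro n. destruct (s n) as [[|i]|v] eqn:E; simpl; rewrite ?E; reflexivity. }
  split; intros A x; apply H, A.
Qed.

Lemma definable_not (P : (nat -> V) -> Prop) :
  definable P -> definable (fun e => ~ P e).
Proof. intro H. apply definable_imp; [exact H | apply definable_false]. Qed.

Lemma definable_and (P Q : (nat -> V) -> Prop) :
  definable P -> definable Q -> definable (fun e => P e /\ Q e).
Proof.
  intros HP HQ. apply (definable_equiv (fun e => ~ (P e -> ~ Q e))).
  - intro e. tauto.
  - apply definable_not, definable_imp, definable_not; assumption.
Qed.

Lemma definable_or (P Q : (nat -> V) -> Prop) :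
  definable P -> definable Q -> definable (fun e => P e \/ Q e).
Proof.
  intros HP HQ. apply (definable_equiv (fun e => ~ P e -> Q e)).
  - intro e. tauto.
  - apply definable_imp; [apply definable_not|]; assumption.
Qed.

Lemma definable_iff (P Q : (nat -> V) -> Prop) :
  definable P -> definable Q -> definable (fun e => P e <-> Q e).
Proof. intros HP HQ. apply definable_and; apply definable_imp; assumption. Qed.

Lemma definable_ex (P : V -> (nat -> V) -> Prop) :
  definable (fun e => P (e 0) (fun n => e (S n))) ->
  definable (fun e => exists x, P x e).
Proof.
  intro H. apply (definable_equiv (fun e => ~ forall x, ~ P x e)).
  - intro e. split.
    + intro A. apply NNPP. firstorder.
    + firstorder.
  - apply definable_not, (definable_all (fun x e => ~ P x e)), definable_not, H.
Qed.

End Definability.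

Ltac is_term_tac :=
  first [apply is_term_parameter | apply is_term_var].

(** Proves [definable P] for [P] built from membership, equality, connectives,
    quantifiers over the model and the set-theoretic notions listed. *)
Ltac definability :=
  cbv beta delta
    [is_empty nonempty subset is_upair is_union is_succ inductive is_omega
     is_opair maps function_on bijection equipotent countable
     is_countable_subsets closed is_diff Fsigma unique];
  repeat (cbv beta; first
    [ simple apply definable_mem; [is_term_tac | is_term_tac]
    | simple apply definable_eq; [is_term_tac | is_term_tac]
    | simple apply definable_false
    | simple apply definable_and
    | simple apply definable_or
    | simple apply definable_iff
    | simple apply definable_not
    | simple apply definable_imp
    | simple apply definable_ex
    | simple apply definable_all ]).

(** * Sets and functions in a model of ZF *)

Section Model.

Context {V : set_structure} (HV : ZF V).

Lemma definable_separation (P : V -> Prop) (a : V) :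
  definable (fun e => P (e 0)) ->
  exists b : V, forall x, x ∈ b <-> x ∈ a /\ P x.
Proof.
  intros [phi [s Hs]].
  destruct (separation V HV
    (rename (fun n => match s n with inl _ => 0 | inr _ => S n end) phi)
    (fun n => match s n with inl _ => a | inr v => v end) a) as [b Hb].
  exists b. intro x. rewrite Hb, (Hs (fun _ => x)).
  rewrite <- (sat_rename phi _ (fun n => value (fun _ => x) (s n))); [tauto|].
  intro n. destruct (s n) eqn:E; simpl; rewrite ?E; reflexivity.
Qed.

Lemma definable_replacement (R : V -> V -> Prop) (a : V) :
  definable (fun e => R (e 0) (e 1)) ->
  (forall x y y', x ∈ a -> R x y -> R x y' -> y = y') ->
  exists b : V, forall y, y ∈ b <-> exists x, x ∈ a /\ R x y.
Proof.
  intros [phi [s Hs]] HR.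
  (* Variables 0 and 1 are argument and value; the parameters are moved to the
     positions from 2 on. *)
  pose (r := fun n => match s n with
                      | inl 0 => 0 | inl (S _) => 1 | inr _ => S (S n) end).
  pose (d := fun n => match s n with inl _ => a | inr v => v end).
  assert (H : forall x y, sat (scons x (scons y d)) (rename r phi) <-> R x y).
  { intros x y.
    rewrite (Hs (fun n => match n with O => x | S _ => y end)).
    rewrite <- (sat_rename phi _
      (fun n => value (fun n => match n with O => x | S _ => y end) (s n)));
      [tauto|].
    intro n. unfold r, d.
    destruct (s n) as [[|i]|v] eqn:E; simpl; rewrite ?E; reflexivity. }
  destruct (replacement V HV (rename r phi) d a) as [b Hb].
  { intros x y y' Hx A B. apply (HR x); [exact Hx | now apply H..]. }
  exists b. intro y. rewrite Hb. split; intros [x [Hx A]]; exists x;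
    (split; [exact Hx | now apply H]).
Qed.

Lemma upair_unique (u v x y : V) : is_upair u x y -> is_upair v x y -> u = v.
Proof.
  intros Hu Hv. apply (extensionality V HV). intro z. now rewrite (Hu z), (Hv z).
Qed.

Lemma upair_inj_l (u x y x' y' : V) :
  is_upair u x y -> is_upair u x' y' -> x = x' \/ x = y'.
Proof. intros H H'. apply H', H. now left. Qed.

Lemma singleton_inj (u x y : V) : is_upair u x x -> is_upair u y y -> x = y.
Proof. intros H H'. destruct (upair_inj_l _ _ _ _ _ H H'); assumption. Qed.

Lemma opair_exists (x y : V) : exists p, is_opair p x y.
Proof.
  destruct (pairing V HV x x) as [u Hu], (pairing V HV x y) as [v Hv].
  destruct (pairing V HV u v) as [p Hp]. now exists p, u, v.
Qed.

Lemma opair_unique (p q x y : V) : is_opair p x y -> is_opair q x y -> p = q.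
Proof.
  intros (u & v & Hu & Hv & Hp) (u' & v' & Hu' & Hv' & Hq).
  rewrite (upair_unique _ _ _ _ Hu' Hu), (upair_unique _ _ _ _ Hv' Hv) in Hq.
  exact (upair_unique _ _ _ _ Hp Hq).
Qed.

Lemma opair_inj (p x y x' y' : V) :
  is_opair p x y -> is_opair p x' y' -> x = x' /\ y = y'.
Proof.
  intros (u & v & Hu & Hv & Hp) (u' & v' & Hu' & Hv' & Hp').
  assert (Ex : x = x').
  { assert (Hup : u ∈ p) by (apply Hp; now left).
    apply Hp' in Hup. destruct Hup as [-> | ->].
    - exact (singleton_inj _ _ _ Hu Hu').
    - assert (Hx' : x' ∈ v') by (apply Hv'; now left).
      apply Hu in Hx'. intuition congruence. }
  subst x'. split; [reflexivity|].
  assert (Hvp : v ∈ p) by (apply Hp; now right).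
  assert (Hvp' : v' ∈ p) by (apply Hp'; now right).
  apply Hp' in Hvp. apply Hp in Hvp'.
  assert (Hy : y ∈ v) by (apply Hv; now right).
  assert (Hy' : y' ∈ v') by (apply Hv'; now right).
  destruct Hvp as [-> | ->].
  - apply Hu' in Hy.
    assert (Exy : y = x) by tauto. subst y.
    destruct Hvp' as [-> | ->].
    + apply Hu in Hy'. intuition congruence.
    + apply Hu' in Hy'. intuition congruence.
  - apply Hv' in Hy. destruct Hy as [-> | ->]; [|reflexivity].
    apply Hv in Hy'. intuition congruence.
Qed.

Lemma maps_dom (f a x y : V) : function_on f a -> maps f x y -> x ∈ a.
Proof.
  intros [H _] (p & Hp & Hpf). destruct (H p Hpf) as (x' & y' & Hx' & Hp').
  now destruct (opair_inj _ _ _ _ _ Hp Hp') as [-> _].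
Qed.

Lemma maps_fun (f a x y y' : V) :
  function_on f a -> maps f x y -> maps f x y' -> y = y'.
Proof.
  intros Hf H H'. destruct (proj2 Hf x (maps_dom _ _ _ _ Hf H)) as (z & _ & Hz).
  now rewrite <- (Hz y H), <- (Hz y' H').
Qed.

Lemma maps_total (f a x : V) : function_on f a -> x ∈ a -> exists y, maps f x y.
Proof. intros [_ H] Hx. destruct (H x Hx) as (y & Hy & _). now exists y. Qed.

(** A definable functional relation on a set [a] has a graph. The hypothesis is
    stated for the formula to which Replacement is applied, which sends the
    argument [x] to the pair [(x, y)]. *)
Lemma definable_function (R : V -> V -> Prop) (a : V) :
  definable (fun e => exists y, is_opair (e 1) (e 0) y /\ R (e 0) y) ->
  (forall x, x ∈ a -> exists! y, R x y) ->
  exists f : V, function_on f a /\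
    forall x y, maps f x y <-> x ∈ a /\ R x y.
Proof.
  intros HD HR.
  destruct (definable_replacement
    (fun x p => exists y, is_opair p x y /\ R x y) a HD) as [f Hf].
  { intros x p p' Hx (y & Hp & Hy) (y' & Hp' & Hy').
    destruct (HR x Hx) as (z & _ & Hz).
    rewrite <- (Hz y Hy) in *. rewrite <- (Hz y' Hy') in *.
    exact (opair_unique _ _ _ _ Hp Hp'). }
  assert (Hmaps : forall x y, maps f x y <-> x ∈ a /\ R x y).
  { intros x y. split.
    - intros (p & Hp & Hpf). apply Hf in Hpf.
      destruct Hpf as (x' & Hx' & y' & Hp' & HR').
      now destruct (opair_inj _ _ _ _ _ Hp Hp') as [-> ->].
    - intros [Hx Hy]. destruct (opair_exists x y) as [p Hp].
      exists p. split; [exact Hp|]. apply Hf. exists x.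
      split; [exact Hx|]. now exists y. }
  exists f. split; [split|exact Hmaps].
  - intros p Hp. apply Hf in Hp. destruct Hp as (x & Hx & y & Hp & _).
    now exists x, y.
  - intros x Hx. destruct (HR x Hx) as (y & Hy & Hu). exists y.
    split; [now apply Hmaps|]. intros y' Hy'. apply Hu. now apply Hmaps.
Qed.

Lemma image_exists (f a : V) :
  function_on f a -> exists d, forall y, y ∈ d <-> exists x, maps f x y.
Proof.
  intro Hf. destruct (definable_replacement (fun x y => maps f x y) a) as [d Hd].
  - definability.
  - intros x y y' _. now apply maps_fun with a.
  - exists d. intro y. rewrite Hd. split.
    + intros (x & _ & H). now exists x.
    + intros (x & H). exists x. split; [now apply maps_dom with f y | exact H].
Qed.

(** * Natural numbers *)

Lemma succ_unique (s s' x : V) : is_succ s x -> is_succ s' x -> s = s'.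
Proof.
  intros H H'. apply (extensionality V HV). intro z. now rewrite (H z), (H' z).
Qed.

Lemma empty_unique (a b : V) : is_empty a -> is_empty b -> a = b.
Proof.
  intros Ha Hb. apply (extensionality V HV). intro z. split; intro H.
  - now destruct (Ha z).
  - now destruct (Hb z).
Qed.

Lemma omega_exists : exists w : V, is_omega w.
Proof.
  destruct (infinity V HV) as [i Hi].
  destruct (definable_separation
    (fun x => forall v, inductive v -> x ∈ v) i) as [w Hw].
  { definability. }
  exists w. split; [split|].
  - destruct Hi as [(o & Ho & Hoi) _]. exists o. split; [exact Ho|].
    apply Hw. split; [exact Hoi|]. intros v [(o' & Ho' & Hov) _].
    now rewrite (empty_unique _ _ Ho Ho').
  - intros x Hx. apply Hw in Hx. destruct Hx as [Hxi Hx].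
    destruct (proj2 Hi x Hxi) as (s & Hs & Hsi). exists s.
    split; [exact Hs|]. apply Hw. split; [exact Hsi|]. intros v Hv.
    destruct (proj2 Hv x (Hx v Hv)) as (s' & Hs' & Hsv).
    now rewrite (succ_unique _ _ _ Hs Hs').
  - intros v Hv x Hx. apply Hw in Hx. now apply Hx.
Qed.

Lemma omega_induction (w : V) (P : V -> Prop) :
  is_omega w -> definable (fun e => P (e 0)) ->
  (forall o, is_empty o -> P o) ->
  (forall n s, n ∈ w -> P n -> is_succ s n -> P s) ->
  forall n, n ∈ w -> P n.
Proof.
  intros [Hw Hmin] HP H0 HS.
  destruct (definable_separation P w HP) as [v Hv].
  assert (Hi : inductive v).
  { split.
    - destruct Hw as [(o & Ho & Hoi) _]. exists o. split; [exact Ho|].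
      apply Hv. split; [exact Hoi | now apply H0].
    - intros n Hn. apply Hv in Hn. destruct Hn as [Hn HPn].
      destruct (proj2 Hw n Hn) as (s & Hs & Hsw). exists s.
      split; [exact Hs|]. apply Hv. split; [exact Hsw|]. now apply (HS n). }
  intros n Hn. now apply (Hmin v Hi), Hv in Hn.
Qed.

Lemma omega_zero_le (w o n : V) :
  is_omega w -> is_empty o -> n ∈ w -> o = n \/ o ∈ n.
Proof.
  intros Hw Ho. revert n. apply (omega_induction w); [exact Hw | definability | |].
  - intros o' Ho'. left. now apply empty_unique.
  - intros n s _ H Hs. right. apply Hs. tauto.
Qed.

Lemma omega_succ_le (w n : V) :
  is_omega w -> n ∈ w ->
  forall m s, m ∈ n -> is_succ s m -> s ∈ n \/ s = n.
Proof.
  intro Hw. revert n.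
  apply (omega_induction w
    (fun n => forall m s, m ∈ n -> is_succ s m -> s ∈ n \/ s = n));
    [exact Hw | definability | |].
  - intros o Ho m s Hm. now destruct (Ho m).
  - intros n t _ IH Ht m s Hm Hs. apply Ht in Hm. destruct Hm as [Hm | ->].
    + left. apply Ht. exact (IH m s Hm Hs).
    + right. exact (succ_unique _ _ _ Hs Ht).
Qed.

Lemma omega_trichotomy (w m n : V) :
  is_omega w -> m ∈ w -> n ∈ w -> m ∈ n \/ m = n \/ n ∈ m.
Proof.
  intros Hw Hm. revert n.
  apply (omega_induction w (fun m => forall n, n ∈ w -> m ∈ n \/ m = n \/ n ∈ m));
    [exact Hw | definability | | | exact Hm].
  - intros o Ho n Hn. destruct (omega_zero_le w o n Hw Ho Hn); tauto.
  - intros k s _ IH Hs n Hn. destruct (IH n Hn) as [H | H].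
    + destruct (omega_succ_le w n Hw Hn k s H Hs); tauto.
    + right. right. apply Hs. destruct H; [right; now symmetry | now left].
Qed.

(** * Countable and finite sets *)

Lemma countable_of_injection (a f w : V) :
  is_omega w -> function_on f a ->
  (forall x n, maps f x n -> n ∈ w) ->
  (forall x x' n, maps f x n -> maps f x' n -> x = x') ->
  countable a.
Proof.
  intros Hw Hf Hfw Hinj. destruct (image_exists f a Hf) as [b Hb].
  exists w, b. split; [exact Hw|]. split.
  - intros n Hn. apply Hb in Hn. destruct Hn as [x Hx]. now apply (Hfw x).
  - exists f. split; [exact Hf|]. split.
    + intros x y H. apply Hb. now exists x.
    + intros y Hy. apply Hb in Hy. destruct Hy as [x Hx]. exists x.
      split; [exact Hx|]. intros x' Hx'. exact (Hinj x x' y Hx Hx').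
Qed.

Lemma singleton_countable (s x : V) : is_upair s x x -> countable s.
Proof.
  intro Hs. destruct omega_exists as [w Hw].
  destruct (proj1 (proj1 Hw)) as (o & Ho & How).
  destruct (definable_function (fun _ n => n = o) s) as (f & Hf & Hmaps).
  { definability. }
  { intros. now exists o. }
  apply (countable_of_injection s f w Hw Hf).
  - intros y n H. apply Hmaps in H. now destruct H as [_ ->].
  - intros y y' n H H'. apply Hmaps in H, H'.
    destruct H as [H _], H' as [H' _]. apply Hs in H, H'. intuition congruence.
Qed.

(** No choice is needed: an element of the image is sent to the least index of
    its preimages. *)
Lemma image_countable (a f d : V) :
  countable a -> function_on f a ->
  (forall y, y ∈ d <-> exists x, maps f x y) -> countable d.
Proof.
  intros (w & b & Hw & Hbw & e & He & Heb & Hei) Hf Hd.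
  assert (Hinj : forall x x' n, maps e x n -> maps e x' n -> x = x').
  { intros x x' n H H'. destruct (Hei n (Heb x n H)) as (z & _ & Hz).
    now rewrite <- (Hz x H), <- (Hz x' H'). }
  destruct (definable_function (fun y n =>
      (exists x, maps f x y /\ maps e x n) /\
      forall x m, maps f x y -> maps e x m -> m ∉ n) d) as (g & Hg & Hmaps).
  { definability. }
  { intros y Hy.
    destruct (definable_separation
      (fun n => exists x, maps f x y /\ maps e x n) w) as [S HS].
    { definability. }
    (* Foundation gives an [∈]-minimal index; trichotomy makes it unique. *)
    destruct (foundation V HV S) as (n & Hn & Hleast).
    { apply Hd in Hy. destruct Hy as [x Hx].
      destruct (maps_total e a x He (maps_dom _ _ _ _ Hf Hx)) as [n Hn].
      exists n. apply HS. split; [exact (Hbw n (Heb x n Hn)) | now exists x]. }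
    apply HS in Hn. destruct Hn as [Hnw Hn].
    exists n. split.
    - split; [exact Hn|]. intros x m Hx Hm Hmn. apply (Hleast m Hmn), HS.
      split; [exact (Hbw m (Heb x m Hm)) | now exists x].
    - intros n' [(x' & Hx' & Hn') Hleast']. destruct Hn as (x & Hx & Hn).
      destruct (omega_trichotomy w n n' Hw Hnw (Hbw n' (Heb x' n' Hn')))
        as [H | [H | H]].
      + now destruct (Hleast' x n Hx Hn).
      + exact H.
      + destruct (Hleast n' H). apply HS.
        split; [exact (Hbw n' (Heb x' n' Hn')) | now exists x']. }
  apply (countable_of_injection d g w Hw Hg).
  - intros y n H. apply Hmaps in H. destruct H as (_ & (x & _ & Hn) & _).
    exact (Hbw n (Heb x n Hn)).
  - intros y y' n H H'. apply Hmaps in H, H'.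
    destruct H as (_ & (x & Hx & Hn) & _), H' as (_ & (x' & Hx' & Hn') & _).
    rewrite (Hinj x' x n Hn' Hn) in Hx'. exact (maps_fun f a x y y' Hf Hx Hx').
Qed.

Lemma finite_choice (A : V) :
  finite A -> (forall a, a ∈ A -> nonempty a) -> has_choice_function A.
Proof.
  intros (w & n & Hw & Hn & e & He & Hen & Hei) Hne.
  assert (Hinj : forall x x' m, maps e x m -> maps e x' m -> x = x').
  { intros x x' m H H'. destruct (Hei m (Hen x m H)) as (z & _ & Hz).
    now rewrite <- (Hz x H), <- (Hz x' H'). }
  (* A choice on the members of [A] with index below [n], by induction on [n];
     the values of [g] elsewhere are irrelevant. *)
  assert (H : exists g, forall x i, maps e x i -> i ∈ n ->
                exists! y, y ∈ x /\ maps g x y).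
  { revert n Hn Hen Hei. intros n Hn _ _. revert n Hn.
    apply (omega_induction w); [exact Hw | definability | |].
    - intros o Ho. exists o. intros x i _ Hi. now destruct (Ho i).
    - intros k s _ [g IH] Hs.
      destruct (classic (exists x, maps e x k)) as [[x0 Hx0] | Hno].
      + destruct (Hne x0 (maps_dom e A x0 k He Hx0)) as [y0 Hy0].
        destruct (definable_separation
          (fun x => exists i, maps e x i /\ i ∈ s) A) as [As HAs].
        { definability. }
        destruct (definable_function (fun x y =>
          (x = x0 /\ y = y0) \/ (x <> x0 /\ y ∈ x /\ maps g x y)) As)
          as (g' & Hg' & Hmaps).
        { definability. }
        { intros x Hx. apply HAs in Hx. destruct Hx as (_ & i & Hi & His).
          destruct (classic (x = x0)) as [-> | Hx].
          - exists y0. split; [tauto|]. intros y Hy. intuition congruence.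
          - apply Hs in His. destruct His as [His | ->].
            + destruct (IH x i Hi His) as (y & Hy & Hu). exists y.
              split; [tauto|]. intros y' Hy'. apply Hu. tauto.
            + now destruct Hx; apply (Hinj _ _ k). }
        exists g'. intros x i Hi His.
        assert (Hx : x ∈ As).
        { apply HAs. split; [exact (maps_dom e A x i He Hi) | now exists i]. }
        destruct (maps_total g' As x Hg' Hx) as [y Hy]. exists y. split.
        * split; [|exact Hy]. apply Hmaps in Hy.
          destruct Hy as [_ [[-> ->] | Hy]]; [exact Hy0 | tauto].
        * intros y' [_ Hy']. exact (maps_fun g' As x y y' Hg' Hy Hy').
      + exists g. intros x i Hi His. apply Hs in His.
        destruct His as [His | ->]; [exact (IH x i Hi His)|].
        destruct Hno. now exists x. }
  destruct H as [g Hg].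
  destruct (definable_function (fun x y => y ∈ x /\ maps g x y) A)
    as (f & Hf & Hmaps).
  { definability. }
  { intros x Hx. destruct (maps_total e A x He Hx) as [i Hi].
    exact (Hg x i Hi (Hen x i Hi)). }
  exists f. split; [exact Hf|]. intros a y _ H. now apply Hmaps in H.
Qed.

Lemma has_choice_function_subset (A D : V) :
  D ⊆ A -> has_choice_function A -> has_choice_function D.
Proof.
  intros HDA (f & Hf & Hc).
  destruct (definable_function (fun x y => maps f x y) D) as (g & Hg & Hmaps).
  { definability. }
  { intros x Hx. apply (proj2 Hf x (HDA x Hx)). }
  exists g. split; [exact Hg|]. intros a y Ha H. apply Hmaps in H.
  apply (Hc a y (HDA a Ha)), H.
Qed.

(** * Families of countable subsets *)

Lemma countable_subsets_exists (a : V) : exists c, is_countable_subsets c a.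
Proof.
  destruct (powerset V HV a) as [p Hp].
  destruct (definable_separation (fun s => countable s /\ ~ is_empty s) p)
    as [c Hc].
  { definability. }
  exists c. intro s. rewrite Hc, (Hp s). tauto.
Qed.

Lemma countable_subsets_unique (c c' a : V) :
  is_countable_subsets c a -> is_countable_subsets c' a -> c = c'.
Proof.
  intros H H'. apply (extensionality V HV). intro s. now rewrite (H s), (H' s).
Qed.

Lemma singleton_countable_subset (c a s x : V) :
  is_countable_subsets c a -> is_upair s x x -> x ∈ a -> s ∈ c.
Proof.
  intros Hc Hs Hx. apply Hc. split; [split|].
  - intros z Hz. apply Hs in Hz. now destruct Hz; subst z.
  - exact (singleton_countable s x Hs).
  - intro H. apply (H x), Hs. now left.
Qed.

Lemma countable_subsets_inj (c a a' : V) :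
  is_countable_subsets c a -> is_countable_subsets c a' -> a = a'.
Proof.
  assert (H : forall b b', is_countable_subsets c b ->
    is_countable_subsets c b' -> b ⊆ b').
  { intros b b' Hb Hb' x Hx. destruct (pairing V HV x x) as [s Hs].
    apply (singleton_countable_subset c b s x Hb Hs), Hb' in Hx.
    apply Hx, Hs. now left. }
  intros Ha Ha'. apply (extensionality V HV).
  intro x. split; [now apply H | now apply H].
Qed.

Lemma countable_subsets_family_exists (A : V) :
  exists B, is_countable_subsets_family B A.
Proof.
  destruct (definable_replacement (fun a c => is_countable_subsets c a) A)
    as [B HB].
  - definability.
  - intros a c c' _. apply countable_subsets_unique.
  - now exists B.
Qed.

(** If a non-empty countable subset [s] of each member of [A] can be chosen, it
    remains to choose from the family of these [s], which is countable when [A]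
    is. *)
Lemma choice_from_countable_subsets (A B : V) :
  is_countable_subsets_family B A -> has_choice_function B ->
  (forall D, (forall s, s ∈ D -> countable s /\ nonempty s /\
                exists a, a ∈ A /\ s ⊆ a) ->
     (countable A -> countable D) -> has_choice_function D) ->
  has_choice_function A.
Proof.
  intros HB (f & Hf & Hc) HD.
  destruct (definable_function
    (fun a s => exists c, is_countable_subsets c a /\ maps f c s) A)
    as (h & Hh & Hmaps).
  { definability. }
  { intros a Ha. destruct (countable_subsets_exists a) as [c Hca].
    assert (HcB : c ∈ B) by (apply HB; now exists a).
    destruct (maps_total f B c Hf HcB) as [s Hs]. exists s.
    split; [now exists c|]. intros s' (c' & Hc' & Hs').
    rewrite (countable_subsets_unique c' c a Hc' Hca) in Hs'.
    exact (maps_fun f B c s s' Hf Hs Hs'). }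
  assert (Hspec : forall a s, maps h a s ->
    a ∈ A /\ s ⊆ a /\ countable s /\ ~ is_empty s).
  { intros a s H. apply Hmaps in H. destruct H as (Ha & c & Hca & Hs).
    split; [exact Ha|].
    apply (Hc c s (maps_dom f B c s Hf Hs)), Hca in Hs. tauto. }
  destruct (image_exists h A Hh) as [D HDi].
  destruct (HD D) as (g & Hg & Hgc).
  { intros s Hs. apply HDi in Hs. destruct Hs as [a Ha].
    destruct (Hspec a s Ha) as (HaA & Hsa & Hsc & Hse).
    split; [exact Hsc|]. split; [|now exists a].
    apply NNPP. intro Hn. apply Hse. intros x Hx. apply Hn. now exists x. }
  { intro HA. exact (image_countable A h D HA Hh HDi). }
  destruct (definable_function
    (fun a y => exists s, maps h a s /\ maps g s y) A) as (k & Hk & Hkm).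
  { definability. }
  { intros a Ha. destruct (maps_total h A a Hh Ha) as [s Hs].
    destruct (maps_total g D s Hg) as [y Hy].
    { apply HDi. now exists a. }
    exists y. split; [now exists s|]. intros y' (s' & Hs' & Hy').
    rewrite (maps_fun h A a s' s Hh Hs' Hs) in Hy'.
    exact (maps_fun g D s y y' Hg Hy Hy'). }
  exists k. split; [exact Hk|]. intros a y Ha H. apply Hkm in H.
  destruct H as (_ & s & Hs & Hy). apply (Hspec a s Hs).
  exact (Hgc s y (maps_dom g D s y Hg Hy) Hy).
Qed.

(** A choice function for [A] chooses singletons from the members of [B]. *)
Lemma choice_of_countable_subsets (A B : V) :
  is_countable_subsets_family B A -> has_choice_function A ->
  has_choice_function B.
Proof.
  intros HB (h & Hh & Hc).
  destruct (definable_function (fun c s => exists a y,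
    is_countable_subsets c a /\ maps h a y /\ is_upair s y y) B)
    as (f & Hf & Hmaps).
  { definability. }
  { intros c Hc'. apply HB in Hc'. destruct Hc' as (a & Ha & Hca).
    destruct (maps_total h A a Hh Ha) as [y Hy].
    destruct (pairing V HV y y) as [s Hs]. exists s.
    split; [now exists a, y|]. intros s' (a' & y' & Hca' & Hy' & Hs').
    rewrite (countable_subsets_inj c a' a Hca' Hca) in Hy'.
    rewrite (maps_fun h A a y' y Hh Hy' Hy) in Hs'.
    exact (upair_unique s s' y y Hs Hs'). }
  exists f. split; [exact Hf|]. intros c s _ H. apply Hmaps in H.
  destruct H as (_ & a & y & Hca & Hy & Hs).
  apply (singleton_countable_subset c a s y Hca Hs).
  exact (Hc a y (maps_dom h A a y Hh Hy) Hy).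
Qed.

(** * F-sigma sets of a T1 space *)

Context (X T : V) (HT : topology X T).

Lemma Fsigma_subset (F : V) : Fsigma X T F -> F ⊆ X.
Proof.
  intros (C & _ & HC & HF) x Hx. apply HF in Hx. destruct Hx as (c & Hc & Hx).
  exact (proj1 (HC c Hc) x Hx).
Qed.

Lemma singleton_closed (s x : V) :
  T1 X T -> x ∈ X -> is_upair s x x -> closed X T s.
Proof.
  intros HT1 Hx Hs. split.
  { intros z Hz. apply Hs in Hz. now destruct Hz; subst z. }
  destruct (definable_separation (fun O => x ∉ O) T) as [C HC].
  { definability. }
  destruct (union V HV C) as [U HU]. exists U. split.
  - apply (open_union X T HT C); [|exact HU]. intros O HO. now apply HC in HO.
  - intro y. split.
    + intro Hy. apply HU in Hy. destruct Hy as (O & HO & Hy).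
      apply HC in HO. destruct HO as [HO HxO].
      split; [exact (open_subset X T HT O HO y Hy)|].
      intro H. apply Hs in H. now destruct H; subst y.
    + intros [Hy Hys]. destruct (HT1 y x Hy Hx) as (O & HO & HyO & HxO).
      { intro E. apply Hys, Hs. now left. }
      apply HU. exists O. split; [|exact HyO]. now apply HC.
Qed.

Lemma countable_Fsigma (s : V) :
  T1 X T -> s ⊆ X -> countable s -> Fsigma X T s.
Proof.
  intros HT1 HsX Hs.
  destruct (definable_function (fun x u => is_upair u x x) s)
    as (f & Hf & Hmaps).
  { definability. }
  { intros x _. destruct (pairing V HV x x) as [u Hu]. exists u.
    split; [exact Hu|]. intros u' Hu'. exact (upair_unique u u' x x Hu Hu'). }
  destruct (image_exists f s Hf) as [C HC]. exists C. split; [|split].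
  - exact (image_countable s f C Hs Hf HC).
  - intros c Hc. apply HC in Hc. destruct Hc as [x Hx]. apply Hmaps in Hx.
    apply (singleton_closed c x HT1); [apply HsX|]; apply Hx.
  - intro x. split.
    + intro Hx. destruct (maps_total f s x Hf Hx) as [u Hu]. exists u. split.
      * apply HC. now exists x.
      * apply Hmaps in Hu. apply Hu. now left.
    + intros (u & Hu & Hxu). apply HC in Hu. destruct Hu as [z Hz].
      apply Hmaps in Hz. destruct Hz as [Hz Hu]. apply Hu in Hxu.
      now destruct Hxu; subst x.
Qed.

Lemma FsigmaL_choice (D : V) :
  FsigmaL X T -> (forall F, F ∈ D -> Fsigma X T F /\ nonempty F) ->
  has_choice_function D.
Proof.
  intros HL HD. destruct (powerset V HV X) as [p Hp].
  destruct (definable_separation (fun F => Fsigma X T F /\ nonempty F) p)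
    as [A HA].
  { definability. }
  assert (HA' : forall F, F ∈ A <-> Fsigma X T F /\ nonempty F).
  { intro F. rewrite HA. split; [tauto|]. intro H. split; [|exact H].
    apply Hp, Fsigma_subset, H. }
  apply (has_choice_function_subset A).
  - intros F HF. apply HA', HD, HF.
  - exact (HL A HA').
Qed.

End Model.

Theorem theorem4p10 (V : set_structure) (HV : ZF V) (X T : V)
    (HT : topology X T) (HT1 : T1 X T) :
  ((FsigmaL X T /\ KW_omega X) <-> AC X) /\
  ((FsigmaL X T /\ CKW_omega X) -> CAC X) /\
  ((CFsigmaL X T /\ CKW_omega X) <-> CAC X).
Proof.
  assert (Hsub : forall A s, nonempty_subsets_family X A ->
    countable s /\ nonempty s /\ (exists a, a ∈ A /\ s ⊆ a) ->
    Fsigma X T s /\ nonempty s).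
  { intros A s HA (Hc & Hne & a & Ha & Hsa). split; [|exact Hne].
    apply (countable_Fsigma HV X T HT s HT1); [|exact Hc].
    intros x Hx. apply (HA a Ha), Hsa, Hx. }
  assert (HF : forall F, Fsigma X T F /\ nonempty F -> F ⊆ X /\ nonempty F).
  { intros F [H H']. split; [exact (Fsigma_subset X T F H) | exact H']. }
  assert (Hiii : CFsigmaL X T -> CKW_omega X -> CAC X).
  { intros HL HK A HA HAd.
    destruct (countable_subsets_family_exists HV A) as [B HB].
    apply (choice_from_countable_subsets HV A B HB (HK A HA HAd B HB)).
    intros D HD HDc. apply HL; [|exact (HDc (proj1 HAd))].
    intros s Hs. exact (Hsub A s HA (HD s Hs)). }
  split; [split|split; [|split]].
  - intros [HL HK] A HA HAi.
    destruct (countable_subsets_family_exists HV A) as [B HB].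
    apply (choice_from_countable_subsets HV A B HB (HK A HA HAi B HB)).
    intros D HD _. apply (FsigmaL_choice HV X T D HL).
    intros s Hs. exact (Hsub A s HA (HD s Hs)).
  - intro HAC. split.
    + intros A HA. destruct (classic (finite A)) as [Hfin | Hinf].
      * apply (finite_choice HV A Hfin). intros a Ha. now apply HA.
      * apply HAC; [|exact Hinf]. intros a Ha. now apply HF, HA.
    + intros A HA HAi B HB.
      exact (choice_of_countable_subsets HV A B HB (HAC A HA HAi)).
  - intros [HL HK]. apply Hiii; [|exact HK].
    intros D HD _. exact (FsigmaL_choice HV X T D HL HD).
  - intros [HL HK]. now apply Hiii.
  - intro HC. split.
    + intros A HA HAc. destruct (classic (finite A)) as [Hfin | Hinf].
      * apply (finite_choice HV A Hfin). intros a Ha. now apply HA.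
      * apply HC; [|now split]. intros a Ha. now apply HF, HA.
    + intros A HA HAd B HB.
      exact (choice_of_countable_subsets HV A B HB (HC A HA HAd)).
Qed.
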